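(* Let $\mathcal{C}$ be an elementary class of Kripke frames. Then the following are equivalent: (i) $\mathcal{C}$ is $\mathrm{ML}(\mathsf{A}^+)$-definable; (ii) $\mathcal{C}$ is closed under taking generated subframes and bounded morphic images, and $\mathcal{C}$ reflects ultrafilter extensions and reflects finitely generated subframes.
   Context: Fix a set $\Phi$ of propositional variables. Formulas of modal logic $\mathrm{ML}$ are in negation normal form: $\varphi ::= p \mid \neg p \mid (\varphi\wedge\varphi) \mid (\varphi\vee\varphi) \mid \Diamond\varphi \mid \Box\varphi$ with $p\in\Phi$. $\mathrm{ML}(\mathsf{A}^+)$ extends this grammar by the single rule $\varphi ::= \mathsf{A}\varphi$ (so the universal modality $\mathsf{A}$ occurs only positively and its dual does not occur). A frame is $\mathfrak{F}=(W,R)$ with $W\neq\emptyset$ and $R\subseteq W\times W$; a model is $(W,R,V)$ with $V:\Phi\to\mathcal{P}(W)$. Satisfaction $\mathfrak{M},w\Vdash\varphi$ is the standard Kripke semantics, with $\mathfrak{M},w\Vdash\mathsf{A}\varphi$ iff $\mathfrak{M},v\Vdash\varphi$ for every $v\in W$. A set $\Gamma$ of formulas is valid in a model if every formula of $\Gamma$ is true at every point; valid in a frame $\mathfrak{F}$ if valid in $(\mathfrak{F},V)$ for every valuation $V$. A class $\mathcal{C}$ of frames is $\mathrm{ML}(\mathsf{A}^+)$-definable if there is a set $\Gamma$ of $\mathrm{ML}(\mathsf{A}^+)$-formulas such that $\mathcal{C}$ is exactly the class of frames in which $\Gamma$ is valid. A class of frames is elementary if it is the class of models of some set of first-order sentences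 (with equality) in the vocabulary $\{R\}$. $\mathfrak{F}'=(W',R')$ is a generated subframe of $\mathfrak{F}=(W,R)$ if $W'\subseteq W$, $R'=R\cap (W')^2$, and whenever $w\in W'$ and $wRv$ then $v\in W'$. For $X\subseteq W$, $\mathfrak{F}_X$ is the smallest generated subframe of $\mathfrak{F}$ whose domain contains $X$; a finitely generated subframe is one of the form $\mathfrak{F}_X$ with $X$ finite. A map $f:W\to W'$ between frames $(W,R)$, $(W',R')$ is a bounded morphism if $wRv$ implies $f(w)R'f(v)$, and $f(w)R'v'$ implies there is $v$ with $wRv$ and $f(v)=v'$; a bounded morphic image is the codomain of a surjective bounded morphism. The ultrafilter extension of $(W,R)$ is $(\mathrm{Uf}(W),R^{ue})$, where $\mathrm{Uf}(W)$ is the set of ultrafilters on $W$ and $\mathcal{U}R^{ue}\mathcal{U}'$ iff for every $X\subseteq W$, $X\in\mathcal{U}'$ implies $\{w\in W: \exists w'\in X\, (wRw')\}\in\mathcal{U}$. A class $\mathcal{C}$ reflects ultrafilter extensions if for every frame $\mathfrak{F}$, the ultrafilter extension of $\mathfrak{F}$ being in $\mathcal{C}$ implies $\mathfrak{F}\in\mathcal{C}$; $\mathcal{C}$ reflects finitely generated subframes if for every frame $\mathfrak{F}$, whenever every finitely generated subframe of $\mathfrak{F}$ is in $\mathcal{C}$, then $\mathfrak{F}\in\mathcal{C}$.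
   Formalization: The set Φ of propositional variables is assumed infinite; for finite Φ the equivalence fails (e.g. for Φ empty there are no formulas, yet the class of reflexive frames is elementary and satisfies (ii)). *)

(* Defs.v *)
From mathcomp Require Import all_boot.
From mathcomp Require Import boolp classical_sets functions cardinality filter.

Set Implicit Arguments.
Unset Strict Implicit.
Unset Printing Implicit Defensive.

Local Open Scope classical_set_scope.

Record frame := Frame {
  world :> Type;
  acc : world -> world -> Prop;
  world_inhabited : inhabited world
}.

(** Formulas of ML(A+), in negation normal form. *)
Inductive mlform (Phi : Type) : Type :=
| Var of Phi
| NVar of Phi
| And of mlform Phi & mlform Phi
| Or of mlform Phi & mlform Phi
| Dia of mlform Phi
| Box of mlform Phi
| Univ of mlform Phi.

Fixpoint mlsat (Phi : Type) (F : frame) (V : Phi -> set F) (w : F)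
    (f : mlform Phi) : Prop :=
  match f with
  | Var p => V p w
  | NVar p => ~ V p w
  | And f g => mlsat V w f /\ mlsat V w g
  | Or f g => mlsat V w f \/ mlsat V w g
  | Dia f => exists2 v, acc w v & mlsat V v f
  | Box f => forall v, acc w v -> mlsat V v f
  | Univ f => forall v, mlsat V v f
  end.

Definition mlvalid (Phi : Type) (Gamma : set (mlform Phi)) (F : frame) : Prop :=
  forall V : Phi -> set F, forall f, Gamma f -> forall w, mlsat V w f.

(* Classes of frames have type [frame -> Prop], not [set frame]: [frame] lives
   in a universe strictly above the one in which [set] is declared. *)

Definition mldefinable (Phi : Type) (C : frame -> Prop) : Prop :=
  exists Gamma : set (mlform Phi), forall F, C F <-> mlvalid Gamma F.

(** First-order formulas with equality in the vocabulary {R}, whose free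
    variables range over 'I_n; a quantifier binds the variable [ord0] of its
    body and shifts the others, and sentences are the formulas with n = 0. *)
Inductive foform : nat -> Type :=
| FBot n : foform n
| FEq n of 'I_n & 'I_n : foform n
| FRel n of 'I_n & 'I_n : foform n
| FImp n of foform n & foform n : foform n
| FAll n of foform n.+1 : foform n.

Definition env_cons (T : Type) n (x : T) (e : 'I_n -> T) : 'I_n.+1 -> T :=
  fun i => oapp e x (unlift ord0 i).

Fixpoint fosat (F : frame) n (f : foform n) : ('I_n -> F) -> Prop :=
  match f in foform n return ('I_n -> F) -> Prop with
  | FBot _ => fun=> False
  | FEq _ i j => fun e => e i = e j
  | FRel _ i j => fun e => acc (e i) (e j)
  | FImp _ f g => fun e => fosat f e -> fosat g e
  | FAll _ f => fun e => forall x, fosat f (env_cons x e)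
  end.

Definition fomodels (F : frame) (s : foform 0) : Prop :=
  forall e : 'I_0 -> F, fosat s e.

Definition elementary (C : frame -> Prop) : Prop :=
  exists T : set (foform 0), forall F, C F <-> forall s, T s -> fomodels F s.

(** D is the domain of a generated subframe of F. *)
Definition generated (F : frame) (D : set F) : Prop :=
  D !=set0 /\ forall w v, D w -> acc w v -> D v.

Lemma subframe_inhabited (F : frame) (D : set F) :
  D !=set0 -> inhabited {w : F | D w}.
Proof. by case=> w Dw; constructor; exists w. Qed.

Definition subframe (F : frame) (D : set F) (D0 : D !=set0) : frame :=
  @Frame {w : F | D w} (fun w v => acc (sval w) (sval v))
    (subframe_inhabited D0).

Definition closed_generated_subframes (C : frame -> Prop) : Prop :=
  forall (F : frame) (D : set F) (gD : generated D),
    C F -> C (subframe (proj1 gD)).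

(* When X is nonempty, [smallest (@generated F) X] is itself generated.  When X
   is empty, it is generated as soon as it is nonempty, i.e., exactly when F has
   a smallest generated subframe, which is then generated by a single point. *)
Definition reflects_fg_subframes (C : frame -> Prop) : Prop :=
  forall F : frame,
    (forall X : set F, finite_set X ->
       forall D0 : smallest (@generated F) X !=set0, C (subframe D0)) ->
    C F.

Definition bounded_morphism (F G : frame) (f : F -> G) : Prop :=
  (forall w v, acc w v -> acc (f w) (f v)) /\
  (forall w v', acc (f w) v' -> exists2 v, acc w v & f v = v').

Definition closed_bounded_morphic_images (C : frame -> Prop) : Prop :=
  forall (F G : frame) (f : F -> G),
    bounded_morphism f -> set_surj [set: F] [set: G] f -> C F -> C G.

Lemma ultrafilters_inhabited (F : frame) :
  inhabited {U : set_system F | UltraFilter U}.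
Proof.
case: (world_inhabited F) => w; constructor.
by exists (principal_filter w); exact: principal_filter_ultra.
Qed.

Definition ultrafilter_extension (F : frame) : frame :=
  @Frame {U : set_system F | UltraFilter U}
    (fun U U' => forall X : set F,
       sval U' X -> sval U [set w | exists2 w', X w' & acc w w'])
    (ultrafilters_inhabited F).

Definition reflects_ultrafilter_extensions (C : frame -> Prop) : Prop :=
  forall F : frame, C (ultrafilter_extension F) -> C F.

(* Main.v *)
From Stdlib Require List.
Require Import Defs.
From mathcomp Require Import all_boot.
From mathcomp Require Import boolp classical_sets functions cardinality filter.

(* From (ii) to (i), let F validate every formula over [Phi] valid in C; as
   formulas are finite and [Phi] is infinite, F then also validates those over
   the larger set of variables [set F].  Reflection allows one to assume that F
   is generated by finitely many points and to prove only that its ultrafilter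
   extension is in C.  Name each subset of F by a variable.  A finite
   disjunction of formulas [A g] refutes finite parts of the A-free theories of
   all the generators at once, so each choice of finite parts is realized in a
   model over a frame of C; an ultraproduct realizes the full theories, and the
   submodel generated by the realizing points satisfies globally the same A-free
   formulas as F.  The union of an omega-chain of regular ultrapowers of this
   submodel is still over a frame of C and realizes every ultrafilter of F, also
   at the successors of a given point, so mapping a point to the set of the
   variables true at it is a bounded morphism onto the ultrafilter extension of
   F. *)

Local Open Scope classical_set_scope.

Set Implicit Arguments.
Unset Strict Implicit.
Unset Printing Implicit Defensive.

(** * Points and successors in the ultrafilter extension *)

Lemma ultra_setC T (U : set_system T) (UU : UltraFilter U) (A : set T) :
  U (~` A) <-> ~ U A.
Proof.
split=> [UnA UA | nUA]; last by case: (in_ultra_setVsetC A UU).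
by apply: (@filter_not_empty _ U _); rewrite -(setICr A); apply: filterI.
Qed.

Definition principal_point (F : frame) (w : F) : ultrafilter_extension F :=
  exist _ (principal_filter w) (principal_filter_ultra w).

(** The sets [B] with [U (box B)] are closed under finite intersection and all meet [A], so together
    with [A] they generate a proper filter; any ultrafilter above it works. *)
Lemma ue_successor (F : frame) (U : ultrafilter_extension F) (A : set F) :
  sval U [set w | exists2 v, A v & acc w v] ->
  exists2 U' : ultrafilter_extension F, acc U U' & sval U' A.
Proof.
case: U => U UU /= UdA.
pose box (B : set F) := [set w | forall v, acc w v -> B v].
have UboxT : U (box setT).
  by apply: (@filterS _ U _ setT) => //; exact: filterT.
pose G := filter_from [set B | U (box B)] (fun B => B `&` A).
have GF : ProperFilter G.
  apply: filter_from_proper.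
    apply: filter_from_filter; first by exists setT.
    move=> B B' UB UB'; exists (B `&` B').
      apply: (@filterS _ U _ _ _ _ (@filterI _ U _ _ _ UB UB')).
      by move=> w [wB wB'] v wv; split; auto.
    by move=> w [[]].
  move=> B UB; have [w [wB [v Av wv]]] := filter_ex (@filterI _ U _ _ _ UB UdA).
  by exists v; split=> //; apply: wB.
have [U' [UU' GU']] := ultraFilterLemma GF.
exists (exist _ U' UU') => /=; last first.
  apply: GU'; by exists setT => // ? [].
move=> X U'X; have [//|UnX] := in_ultra_setVsetC
  [set w | exists2 w', X w' & acc w w'] UU.
suff /(ultra_setC UU') : U' (~` X) by [].
apply: GU'; exists (~` X); last by move=> ? [].
by apply: (@filterS _ U _ _ _ _ UnX) => w nX v wv Xv; apply: nX; exists v.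
Qed.

(** * Preservation of validity *)

Section Preservation.
Variable Phi : Type.
Implicit Types (f : mlform Phi) (F G : frame).

(** [A] quantifies over fewer points in the subframe, so truth only passes downwards. *)
Lemma mlsat_restrict F (D : set F) (gD : generated D) (V : Phi -> set F) f
    (w : subframe (proj1 gD)) :
  mlsat V (sval w) f ->
  @mlsat Phi (subframe (proj1 gD)) (fun p => [set x | V p (sval x)]) w f.
Proof.
elim: f w => //= [f IHf g IHg|f IHf g IHg|f IHf|f IHf|f IHf] w.
- by case=> /IHf ? /IHg.
- by case=> [/IHf|/IHg]; [left | right].
- case=> v wv fv; have Dv := (proj2 gD) _ _ (svalP w) wv.
  by exists (exist _ v Dv) => //; apply: IHf.
- by move=> fw v wv; apply: IHf; apply: fw.
- by move=> fw v; apply: IHf.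
Qed.

Lemma mlvalid_subframe (Gamma : set (mlform Phi)) F (D : set F)
    (gD : generated D) :
  mlvalid Gamma F -> mlvalid Gamma (subframe (proj1 gD)).
Proof.
move=> GF V f Gf w.
(* [V'] extends [V] by making every variable false outside [D]. *)
pose V' p := [set x | exists Dx : D x, V p (exist _ x Dx)].
have -> : V = fun p => [set x | V' p (sval x)].
  apply/funext => p; apply/seteqP; split=> -[x Dx] /=; first by exists Dx.
  by case=> Dx'; rewrite (Prop_irrelevance Dx' Dx).
by apply: mlsat_restrict; apply: GF.
Qed.

Lemma mlsat_pullback F G (h : F -> G) (V : Phi -> set G) f w :
  bounded_morphism h -> set_surj [set: F] [set: G] h ->
  mlsat (fun p => h @^-1` V p) w f -> mlsat V (h w) f.
Proof.
move=> [hom back] surj.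
elim: f w => //= [f IHf g IHg|f IHf g IHg|f IHf|f IHf|f IHf] w.
- by case=> /IHf ? /IHg.
- by case=> [/IHf|/IHg]; [left | right].
- by case=> v /hom wv /IHf; exists (h v).
- by move=> fw _ /back[v wv <-]; apply: IHf; apply: fw.
- by move=> fw v; have [//|x _ <-] := surj v; apply: IHf.
Qed.

(** For [Box], a failure at [U] would give, by [ue_successor], a successor of [U] containing the set
    where [f] is false. For [A] it is enough to look at principal ultrafilters, which stand for the
    points of [F]. *)
Lemma mlsat_ue F (V : Phi -> set F) f (U : ultrafilter_extension F) :
  @mlsat Phi (ultrafilter_extension F) (fun p => [set U | sval U (V p)]) U f ->
  sval U [set w | mlsat V w f].
Proof.
elim: f U => [p|p|f IHf g IHg|f IHf g IHg|f IHf|f IHf|f IHf] [U UU] //=.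
- by move/(ultra_setC UU).
- by case=> /IHf /= ? /IHg /= ?; apply: filterI.
- by case=> [/IHf|/IHg] /=; apply: filterS => w; [left | right].
- case=> U' UU' /IHf/UU' /=; apply: filterS => w [v]; by exists v.
- move=> fU; apply: contrapT => /(ultra_setC UU) UnB.
  have [] := @ue_successor F (exist _ U UU) [set v | ~ mlsat V v f].
    apply: filterS UnB => w /existsNP[v /not_implyP[wv nfv]].
    by exists v.
  move=> U' /fU/IHf fU' nfU'.
  by have /(ultra_setC (svalP U')) := nfU'.
- move=> fU; apply: filterS filterT => w _ v.
  by have := IHf _ (fU (principal_point v)) => /principal_filterP.
Qed.

(* [A f] occurs only positively, so it is enough to keep one falsifying point
   for each subformula [A f] that is false in [F]: its truth value does not
   depend on the point of evaluation. *)
Lemma mlsat_fg_reflect F (V : Phi -> set F) f :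
  exists2 X : set F, finite_set X &
    forall (D : set F) (D0 : D !=set0) (w : subframe D0), generated D ->
      X `<=` D ->
      @mlsat Phi (subframe D0) (fun p => [set x | V p (sval x)]) w f ->
      mlsat V (sval w) f.
Proof.
elim: f => [p|p|f [X fX IHf] g [Y fY IHg]|f [X fX IHf] g [Y fY IHg]
  |f [X fX IHf]|f [X fX IHf]|f [X fX IHf]].
- by exists set0.
- by exists set0.
- exists (X `|` Y); first by rewrite finite_setU.
  move=> D D0 w gD; rewrite subUset => -[XD YD] /=.
  by case=> /IHf ? /IHg; auto.
- exists (X `|` Y); first by rewrite finite_setU.
  move=> D D0 w gD; rewrite subUset => -[XD YD] /=.
  by case=> [/IHf|/IHg]; auto.
- exists X => // D D0 w gD XD /= [v wv /IHf fv].
  by exists (sval v); auto.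
- exists X => // D D0 w gD XD /= fw v wv.
  have Dv := (proj2 gD) _ _ (svalP w) wv.
  exact: (IHf _ _ (exist _ v Dv) gD XD (fw (exist _ v Dv) wv)).
- have [fT|/existsNP[v nfv]] := pselect (forall v, mlsat V v f).
    by exists X.
  exists (X `|` [set v]); first by rewrite finite_setU; split.
  move=> D D0 w gD; rewrite subUset => -[XD vD] /= fw.
  case: nfv; have Dv := vD _ erefl.
  exact: (IHf _ _ (exist _ v Dv) gD XD (fw (exist _ v Dv))).
Qed.

Lemma smallest_generated F (X : set F) :
  smallest (@generated F) X !=set0 -> generated (smallest (@generated F) X).
Proof.
move=> D0; split=> // w v Dw wv E [gE XE].
by apply: (proj2 gE) wv; apply: Dw.
Qed.

Lemma definable_closure (C : frame -> Prop) :
  mldefinable Phi C ->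
  [/\ closed_generated_subframes C, closed_bounded_morphic_images C,
      reflects_ultrafilter_extensions C & reflects_fg_subframes C].
Proof.
case=> Gamma CE; split.
- by move=> F D gD /CE CF; apply/CE; apply: mlvalid_subframe.
- move=> F G h bh sh /CE CF; apply/CE => V f Gf w.
  have [//|x _ <-] := sh w.
  by apply: mlsat_pullback => //; apply: CF.
- move=> F /CE CF; apply/CE => V f Gf w.
  have := CF (fun p => [set U | sval U (V p)]) f Gf (principal_point w).
  by move/mlsat_ue/principal_filterP.
- move=> F CF; apply/CE => V f Gf w.
  have [X finX XP] := mlsat_fg_reflect V f.
  pose D := smallest (@generated F) (X `|` [set w]).
  have XD : X `|` [set w] `<=` D by exact: sub_gen_smallest.
  have Dw : D w by apply: XD; right.
  have D0 : D !=set0 by exists w.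
  apply: (XP D D0 (exist _ w Dw)).
  - exact: smallest_generated.
  - by move=> x Xx; apply: XD; left.
  - have /CE CD : C (subframe D0).
      by apply: CF; rewrite finite_setU; split.
    exact: CD.
Qed.

End Preservation.

(** * Ultraproducts *)

Record model (Psi : Type) := Model {
  mframe :> frame;
  mval : Psi -> set mframe
}.

(* [foform] extended with a unary predicate for each variable in [Psi], so that
   both frame conditions and modal formulas over a model can be expressed. *)
Inductive lform (Psi : Type) : nat -> Type :=
| LBot n : lform Psi n
| LEq n of 'I_n & 'I_n : lform Psi n
| LRel n of 'I_n & 'I_n : lform Psi n
| LPred n of Psi & 'I_n : lform Psi n
| LImp n of lform Psi n & lform Psi n : lform Psi n
| LAll n of lform Psi n.+1 : lform Psi n.

Fixpoint lsat (Psi : Type) (M : model Psi) n (f : lform Psi n) :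
    ('I_n -> M) -> Prop :=
  match f in lform _ n return ('I_n -> M) -> Prop with
  | LBot _ => fun=> False
  | LEq _ i j => fun e => e i = e j
  | LRel _ i j => fun e => acc (e i) (e j)
  | LPred _ p i => fun e => mval p (e i)
  | LImp _ f g => fun e => lsat f e -> lsat g e
  | LAll _ f => fun e => forall x, lsat f (env_cons x e)
  end.

Definition LNot (Psi : Type) n (f : lform Psi n) := LImp f (LBot Psi n).

Fixpoint lform_of_fo (Psi : Type) n (f : foform n) : lform Psi n :=
  match f in foform n return lform Psi n with
  | FBot n => LBot Psi n
  | FEq _ i j => LEq Psi i j
  | FRel _ i j => LRel Psi i j
  | FImp _ f g => LImp (lform_of_fo Psi f) (lform_of_fo Psi g)
  | FAll _ f => LAll (lform_of_fo Psi f)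
  end.

Lemma lsat_of_fo (Psi : Type) (M : model Psi) n (f : foform n) (e : 'I_n -> M) :
  lsat (lform_of_fo Psi f) e <-> fosat f e.
Proof.
elim: f e => //= {}n.
  by move=> f IHf g IHg e; split=> fg /IHf/fg/IHg.
by move=> f IHf e; split=> fA x; apply/IHf.
Qed.

(* The standard translation, evaluated at the variable [i]. *)
Fixpoint std_trans (Psi : Type) (f : mlform Psi) n (i : 'I_n) : lform Psi n :=
  match f with
  | Var p => LPred p i
  | NVar p => LNot (LPred p i)
  | And f g => LNot (LImp (std_trans f i) (LNot (std_trans g i)))
  | Or f g => LImp (LNot (std_trans f i)) (std_trans g i)
  | Dia f => LNot (LAll (LImp (LRel Psi (lift ord0 i) ord0)
                              (LNot (std_trans f ord0))))
  | Box f => LAll (LImp (LRel Psi (lift ord0 i) ord0) (std_trans f ord0))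
  | Univ f => LAll (std_trans f (@ord0 n))
  end.

Lemma env_cons0 T n (x : T) (e : 'I_n -> T) : env_cons x e ord0 = x.
Proof. by rewrite /env_cons unlift_none. Qed.

Lemma env_consS T n (x : T) (e : 'I_n -> T) i :
  env_cons x e (lift ord0 i) = e i.
Proof. by rewrite /env_cons liftK. Qed.

Lemma lsat_std_trans (Psi : Type) (M : model Psi) (f : mlform Psi) n (i : 'I_n)
    (e : 'I_n -> M) :
  lsat (std_trans f i) e <-> mlsat (@mval Psi M) (e i) f.
Proof.
elim: f n i e => //= [f IHf g IHg|f IHf g IHg|f IHf|f IHf|f IHf] n i e.
- rewrite IHf IHg; split=> [nfg|[fi gi] fg]; last exact: fg.
  by split; apply: contrapT => ?; apply: nfg => // ?.
- rewrite IHf IHg; split=> [fg|[] //].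
  have [|nf] := pselect (mlsat (@mval Psi M) (e i) f); first by left.
  by right; apply: fg.
- split=> [ex|[v wv fv] nf]; last first.
    by apply: (nf v); rewrite ?env_cons0 ?env_consS// IHf env_cons0.
  apply: contrapT => nex; apply: ex => v; rewrite env_cons0 env_consS IHf.
  by rewrite env_cons0 => wv fv; apply: nex; exists v.
- by split=> fA v; move: (fA v); rewrite env_cons0 env_consS IHf env_cons0.
- by split=> fA v; move: (fA v); rewrite IHf env_cons0.
Qed.

Section Ultraproduct.
Variables (Psi I : Type) (M : I -> model Psi) (D : set_system I).
Hypothesis UD : UltraFilter D.
(* Restricting the product to a subset [P] yields at once ultraproducts
   ([P = setT]) and direct limits of chains ([P] = eventually coherent
   sequences). *)
Variable P : set (forall i, M i).
Hypothesis P0 : P !=set0.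

Local Notation S := {s : forall i, M i | P s}.

Definition uclass (s : S) : set S := [set t | D [set i | sval s i = sval t i]].

Definition upoint (s : S) : {c : set S | exists s, c = uclass s} :=
  exist _ (uclass s) (ex_intro _ s erefl).

Lemma upoint_eq s t : upoint s = upoint t <-> D [set i | sval s i = sval t i].
Proof.
split=> [/(congr1 sval)/= st|Dst].
  suff : uclass s t by [].
  by rewrite st /uclass/=; apply: filterS filterT.
have st : uclass s = uclass t.
  apply/seteqP; split=> u; rewrite /uclass/= => Du.
    by apply: filterS (filterI Dst Du) => i [/= <-].
  by apply: filterS (filterI Dst Du) => i [/= ->].
exact: eq_exist.
Qed.

Lemma upoint_surj c : exists s, c = upoint s.
Proof. by case: c => c [s cE]; exists s; apply: eq_exist. Qed.

Lemma uinhabited : inhabited {c : set S | exists s, c = uclass s}.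
Proof. by case: P0 => s Ps; constructor; exact: (upoint (exist _ s Ps)). Qed.

Definition uframe : frame :=
  @Frame {c : set S | exists s, c = uclass s}
    (fun c d => exists s t, [/\ c = upoint s, d = upoint t &
       D [set i | acc (sval s i) (sval t i)]]) uinhabited.

Definition uproduct : model Psi :=
  @Model Psi uframe
    (fun p c => exists2 s, c = upoint s & D [set i | mval p (sval s i)]).

Lemma uacc (s t : S) :
  @acc uproduct (upoint s) (upoint t) <->
  D [set i | acc (sval s i) (sval t i)].
Proof.
split=> [[s' [t' [/upoint_eq ss' /upoint_eq tt' Dst]]]|]; last by exists s, t.
by apply: filterS (filterI Dst (filterI ss' tt')) => i [/= + [-> ->]].
Qed.

Lemma uval p (s : S) :
  @mval _ uproduct p (upoint s) <-> D [set i | mval p (sval s i)].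
Proof.
split=> [[s' /upoint_eq ss' Ds]|]; last by exists s.
by apply: filterS (filterI Ds ss') => i [/= + ->].
Qed.

(* The Tarski-Vaught condition for [P]. *)
Definition witnessed := forall n (f : lform Psi n.+1) (e : 'I_n -> S),
  D [set i | exists x, lsat f (env_cons x (fun k => sval (e k) i))] ->
  exists s : S,
    D [set i | lsat f (env_cons (sval s i) (fun k => sval (e k) i))].

(** This is Los's theorem: implication uses that [D] is ultra, and for the quantifier [PW] supplies
    a sequence of [P] that falsifies the body on a set of [D]. *)
Lemma los (PW : witnessed) n (f : lform Psi n) (e : 'I_n -> S) :
  @lsat _ uproduct n f (upoint \o e) <->
  D [set i | lsat f (fun k => sval (e k) i)].
Proof.
elim: f e => {n} [n|n j k|n j k|n p j|n f IHf g IHg|n f IHf] e /=.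
- by split=> // /filter_ex[].
- exact: upoint_eq.
- exact: uacc.
- exact: uval.
- rewrite IHf IHg; split=> [fg|Dfg Df]; last first.
    by apply: filterS (filterI Dfg Df) => i [/= fg /fg].
  have [Df|/(ultra_setC UD) nDf] :=
    pselect (D [set i | lsat f (fun k => sval (e k) i)]).
    by apply: filterS (fg Df) => i /= gi _.
  by apply: filterS nDf => i /= nf /nf.
- have cons s : env_cons (upoint s) (upoint \o e) = upoint \o env_cons s e.
    by apply/funext => k; rewrite /env_cons/=; case: unliftP.
  have consi s i : env_cons (sval s i) (fun k => sval (e k) i) =
      fun k => sval (env_cons s e k) i.
    by apply/funext => k; rewrite /env_cons/=; case: unliftP.
  split=> [fA|DfA c]; last first.
    have [s ->] := upoint_surj c; rewrite cons IHf.
    by apply: filterS DfA => i /(_ (sval s i)); rewrite consi.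
  apply: contrapT => /(ultra_setC UD) nDfA.
  have [|s Ds] := PW n (LNot f) e.
    by apply: filterS nDfA => i /existsNP.
  have := fA (upoint s); rewrite cons IHf => Df.
  have [i [/= + +]] := filter_ex (filterI Ds Df).
  by rewrite consi; apply.
Qed.

Lemma elementary_uproduct (C : frame -> Prop) :
  witnessed -> elementary C -> (forall i, C (M i)) -> C uproduct.
Proof.
move=> PW [T CE] CM; apply/CE => f Tf e.
have {e}-> : e = upoint \o (fun k : 'I_0 => False_rect S (notF (ltn_ord k))).
  by apply/funext => -[].
apply/(@lsat_of_fo Psi uproduct)/(los PW); apply: filterS filterT => i _.
by have /CE Mi := CM i; apply/lsat_of_fo; exact: Mi.
Qed.

Lemma mlsat_uproduct (PW : witnessed) (f : mlform Psi) (s : S) :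
  mlsat (@mval _ uproduct) (upoint s) f <->
  D [set i | mlsat (@mval _ (M i)) (sval s i) f].
Proof.
have := los PW (std_trans f ord0) (fun _ : 'I_1 => s).
rewrite (@lsat_std_trans _ uproduct)/= => ->.
by split; apply: filterS => i; rewrite /= lsat_std_trans.
Qed.

End Ultraproduct.

Arguments upoint {Psi I} M D {P} s.
Arguments uproduct {Psi I} M D {P} P0 : simpl never.

(** Witnesses are chosen coordinatewise, with an arbitrary point where none exists. *)
Lemma witnessedT (Psi I : Type) (M : I -> model Psi) (D : set_system I) :
  UltraFilter D -> witnessed (M := M) D setT.
Proof.
move=> UD n f e De.
have ch i : exists x : M i,
    (exists x, lsat f (env_cons x (fun k => sval (e k) i))) ->
    lsat f (env_cons x (fun k => sval (e k) i)).
  have [[x fx]|nx] := pselect (exists x : M i,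
    lsat f (env_cons x (fun k => sval (e k) i))); first by exists x.
  by case: (world_inhabited (M i)) => x; exists x.
exists (exist _ (fun i => sval (cid (ch i))) Logic.I).
by apply: filterS De => i; apply: svalP (cid (ch i)).
Qed.

(** * Chains of ultrapowers *)

(** With finite lists as indices, coordinate [l] of an ultraproduct has to meet only the
    requirements listed in [l], and the class then meets all requirements in [T]. *)
Lemma regular_ultrafilter (T : Type) :
  exists D : set_system (seq T),
    UltraFilter D /\ forall x, D [set l | List.In x l].
Proof.
pose G := filter_from [set: seq T]
  (fun l => [set l' | forall x, List.In x l -> List.In x l']).
have GF : ProperFilter G.
  apply: filter_from_proper; last by move=> l _; exists l.
  apply: filter_fromT_filter; first by exists [::].
  move=> l l'; exists (l ++ l') => k lk.
  by split=> x xl; apply: lk; apply/List.in_or_app; [left | right].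
have [D [UD GD]] := ultraFilterLemma GF.
by exists D; split=> // x; apply: GD; exists [:: x] => // l; apply; left.
Qed.

Lemma ultra_cst T (U : set_system T) (UU : UltraFilter U) (Q : Prop) :
  U [set _ | Q] <-> Q.
Proof.
split=> [/filter_ex[] //|q].
by apply: filterS filterT.
Qed.

Fixpoint univ_free (Phi : Type) (f : mlform Phi) : Prop :=
  match f with
  | Var _ | NVar _ => True
  | And f g | Or f g => univ_free f /\ univ_free g
  | Dia f | Box f => univ_free f
  | Univ _ => False
  end.

Lemma ue_point_eq (F : frame) (U U' : ultrafilter_extension F) :
  sval U `<=` sval U' -> U' = U.
Proof.
case: U U' => [U UU] [U' UU'] /= UU'le; apply: eq_exist.
exact: (@max_filter _ _ UU U' (@ultra_proper _ _ UU') UU'le).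
Qed.

Section Saturation.
Variable F : frame.
Implicit Types N : model (set F).

Definition regular := sval (cid (regular_ultrafilter (set F))).

Lemma regular_ultra : UltraFilter regular.
Proof. by rewrite /regular; case: cid => D []. Qed.

Lemma regularP A : regular [set l | List.In A l].
Proof. by rewrite /regular; case: cid => D [? ?]. Qed.

Lemma cst_seq_nonempty N : (setT : set (seq (set F) -> N)) !=set0.
Proof. by case: (world_inhabited N) => x; exists (fun=> x). Qed.

Definition upower N : model (set F) :=
  uproduct (fun=> N) regular (cst_seq_nonempty N).

Arguments upower : simpl never.

Definition diag N (x : N) : upower N :=
  upoint (fun=> N) regular
    (exist (@setT (seq (set F) -> N)) (fun=> x) Logic.I).

(** Los's theorem for constant sequences: the diagonal embedding is elementary. *)
Lemma lsat_diag N n (f : lform (set F) n) (e : 'I_n -> N) :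
  @lsat _ (upower N) n f (@diag N \o e) <-> lsat f e.
Proof.
have UD := regular_ultra.
have := los UD (cst_seq_nonempty N) (@witnessedT _ _ (fun=> N) _ UD) f
  (fun k => exist _ (fun=> e k) Logic.I).
by move=> H; rewrite -(ultra_cst UD (lsat f e)); exact: H.
Qed.

(* [id] is the valuation under which each variable [A : set F] denotes [A]. *)
Definition same_ml_theory N := forall f : mlform (set F), univ_free f ->
  (forall x : N, mlsat (@mval _ N) x f) <-> (forall w, mlsat id w f).

Lemma ultrafilter_list_bigI (U : set_system F) (UU : UltraFilter U) l :
  U [set w | forall A, List.In A l -> U A -> A w].
Proof.
elim: l => [|A l IHl]; first by apply: filterS filterT => w _ A.
have [UA|nUA] := pselect (U A).
  by apply: filterS (filterI IHl UA) => w [lw Aw] B [<- //|/lw].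
by apply: filterS IHl => w lw B [<- //|/lw].
Qed.

(** Inclusion is the global truth of an A-free formula, which [NF] transfers from [F] to [N]. *)
Lemma mval_mono N (NF : same_ml_theory N) (A B : set F) :
  A `<=` B -> @mval _ N A `<=` @mval _ N B.
Proof.
move=> AB x Ax; have /(NF (Or (NVar A) (Var B)))/(_ x) : forall w,
    mlsat id w (Or (NVar A) (Var B)).
  by move=> w /=; have [/AB|] := pselect (A w); [right | left].
by case.
Qed.

(** The members of [U] in a list [l] have their intersection in [U], so some point of [Q] satisfies
    it; this point becomes coordinate [l]. Keeping all coordinates in [Q] later makes the class a
    successor of a given point. *)
Lemma upower_realizes N (NF : same_ml_theory N) (U : ultrafilter_extension F)
    (Q : set N) :
  (forall A, sval U A -> exists2 x, Q x & mval A x) ->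
  exists s : {s : seq (set F) -> N | setT s},
    (forall l, Q (sval s l)) /\
    forall A, sval U A ->
      @mval _ (upower N) A (upoint (fun=> N) regular s).
Proof.
case: U => U UU /= UQ; have UD := regular_ultra.
have ch l : exists x,
    Q x /\ mval [set w | forall A, List.In A l -> U A -> A w] x.
  by have [x Qx Ax] := UQ _ (ultrafilter_list_bigI UU l); exists x.
have [s sP] := choice ch.
exists (exist _ s Logic.I); split=> [l|A UA]; first by case: (sP l).
apply/(uval UD (cst_seq_nonempty N)); apply: filterS (regularP A) => l /= Al.
by have [_] := sP l; apply: mval_mono NF _ _ _ _ => w; apply.
Qed.

(** Global truth of [f] is the truth of [Univ f], whose translation the diagonal embedding
    preserves. *)
Lemma same_ml_theory_upower N : same_ml_theory N -> same_ml_theory (upower N).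
Proof.
move=> NF f fU; rewrite -NF //; have [x] := world_inhabited N.
have := @lsat_diag N _ (std_trans (Univ f) ord0) (fun _ : 'I_1 => x).
by rewrite !lsat_std_trans.
Qed.

(** * The omega-chain and its direct limit *)

Fixpoint chain N n : model (set F) :=
  if n is m.+1 then upower (chain N m) else N.

Lemma nonprincipal_ultrafilter :
  exists D : set_system nat, UltraFilter D /\ \oo `<=` D.
Proof. exact: ultraFilterLemma. Qed.

Definition nonprincipal := sval (cid nonprincipal_ultrafilter).

Lemma nonprincipal_ultra : UltraFilter nonprincipal.
Proof. by rewrite /nonprincipal; case: cid => D []. Qed.

Lemma nonprincipal_ge n : nonprincipal [set m | n <= m].
Proof.
rewrite /nonprincipal; case: cid => D [UD ooD] /=.
by apply: ooD; exists n.
Qed.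

Definition coherent_from N k (s : forall n, chain N n) :=
  forall n, k <= n -> s n.+1 = diag (s n).

Definition coherent N : set (forall n, chain N n) :=
  [set s | exists k, coherent_from k s].

(** Recursion started at index [k] would need a cast of [x]; induction on [k] with the family [T]
    shifted by one avoids it. Entries below [k] are arbitrary. *)
Lemma coherent_extend (T : nat -> Type) (Tinh : forall n, inhabited (T n))
    (d : forall n, T n -> T n.+1) k (x : T k) :
  exists s : forall n, T n, s k = x /\ forall n, k <= n -> s n.+1 = d n (s n).
Proof.
elim: k T Tinh d x => [|k IHk] T Tinh d x.
  by exists (fix s n := if n is m.+1 return T n then d m (s m) else x).
have [s [sk sd]] := IHk (fun n => T n.+1) (fun n => Tinh n.+1)
  (fun n => @d n.+1) x.
have [y] := Tinh 0.
exists (fun n => if n is m.+1 return T n then s m else y); split=> //.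
by case=> // n /sd.
Qed.

Lemma coherent_through N k (x : chain N k) :
  exists2 s, coherent_from k s & s k = x.
Proof.
have inh n : inhabited (chain N n) := world_inhabited (chain N n).
have [s [sk sd]] := coherent_extend inh (fun n => @diag (chain N n)) x.
by exists s.
Qed.

Lemma coherent_nonempty N : @coherent N !=set0.
Proof.
have [x] := world_inhabited N.
by have [s sd _] := @coherent_through N 0 x; exists s, 0.
Qed.

(** Since tails belong to [nonprincipal], eventually coherent sequences are identified exactly when
    they agree from some index on. *)
Definition chain_limit N : model (set F) :=
  uproduct (chain N) nonprincipal (coherent_nonempty N).

Lemma lsat_coherent N k n (f : lform (set F) n)
    (e : 'I_n -> forall m, chain N m) :
  (forall i, coherent_from k (e i)) -> forall m, k <= m ->
  @lsat _ (chain N m) n f (fun i => e i m) <->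
  @lsat _ (chain N k) n f (fun i => e i k).
Proof.
move=> ek; elim=> [|m IHm]; first by rewrite leqn0 => /eqP ->.
rewrite leq_eqVlt => /predU1P[<- //|km].
rewrite -IHm //.
have -> : (fun i => e i m.+1) = @diag (chain N m) \o (fun i => e i m).
  by apply/funext => i; apply: ek.
exact: (@lsat_diag (chain N m)).
Qed.

Lemma coherent_from_env N n (e : 'I_n -> {s | @coherent N s}) :
  exists k, forall i, coherent_from k (sval (e i)).
Proof.
pose k i := sval (cid (svalP (e i))).
have kP i : coherent_from (k i) (sval (e i)) := svalP (cid (svalP (e i))).
exists (\max_i k i) => i m km; apply: kP.
by apply: leq_trans km; apply: leq_bigmax.
Qed.

(** A witness at one stage [k], from which on all parameters are coherent, is carried along the
    diagonal embeddings and stays a witness at every later stage. *)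
Lemma coherent_witnessed N :
  witnessed (M := chain N) nonprincipal (@coherent N).
Proof.
move=> n f e Df; have UD := nonprincipal_ultra.
have [k0 k0e] := coherent_from_env e.
have [k [/= k0k [x fx]]] := filter_ex (filterI (nonprincipal_ge k0) Df).
have [s sd sk] := coherent_through x.
exists (exist _ s (ex_intro _ k sd)).
apply: filterS (nonprincipal_ge k) => m /= km.
pose e' : 'I_n.+1 -> forall m, chain N m := env_cons s (fun i => sval (e i)).
have e'k i : coherent_from k (e' i).
  rewrite /e' /env_cons; case: unliftP => [j _|_] //= p kp.
  by apply: k0e; apply: leq_trans k0k kp.
have e'E p : env_cons (s p) (fun i => sval (e i) p) = fun i => e' i p.
  by apply/funext => i; rewrite /e' /env_cons/=; case: unliftP.
rewrite e'E (lsat_coherent _ e'k km) -e'E sk.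
exact: fx.
Qed.

(** This is Tarski's elementary chain theorem: each stage embeds elementarily into the limit. *)
Lemma lsat_chain_limit N n (f : lform (set F) n)
    (e : 'I_n -> {s | @coherent N s}) k :
  (forall i, coherent_from k (sval (e i))) ->
  @lsat _ (chain_limit N) n f (upoint (chain N) nonprincipal \o e) <->
  lsat f (fun i => sval (e i) k).
Proof.
move=> ek; have UD := nonprincipal_ultra.
have := los UD (coherent_nonempty N) (@coherent_witnessed N) f e.
move=> ->; rewrite -(ultra_cst UD (lsat f _)).
by split=> Df; apply: filterS (filterI (nonprincipal_ge k) Df) => m [km];
  rewrite /= (lsat_coherent f ek km).
Qed.

Lemma mlsat_chain_limit N (f : mlform (set F)) (s : {s | @coherent N s}) k :
  coherent_from k (sval s) ->
  @mlsat _ (chain_limit N) (@mval _ (chain_limit N))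
    (upoint (chain N) nonprincipal s) f <->
  mlsat (@mval _ (chain N k)) (sval s k) f.
Proof.
move=> sk.
have := @lsat_chain_limit N _ (std_trans f ord0) (fun _ : 'I_1 => s) k
  (fun=> sk).
by rewrite !lsat_std_trans.
Qed.

Lemma same_ml_theory_chain N k :
  same_ml_theory N -> same_ml_theory (chain N k).
Proof. by move=> NF; elim: k => //= k IHk; apply: same_ml_theory_upower. Qed.

Lemma same_ml_theory_chain_limit N :
  same_ml_theory N -> same_ml_theory (chain_limit N).
Proof.
move=> NF f fU; rewrite -NF //; have [x] := world_inhabited N.
have [s s0 _] := @coherent_through N 0 x.
exact: (@mlsat_chain_limit N (Univ f) (exist _ s (ex_intro _ 0 s0)) 0 s0).
Qed.

Lemma acc_chain_limit N (s t : {s | @coherent N s}) k :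
  coherent_from k (sval s) -> coherent_from k (sval t) ->
  @acc (chain_limit N) (upoint (chain N) nonprincipal s)
    (upoint (chain N) nonprincipal t) <->
  acc (sval s k) (sval t k).
Proof.
move=> sk tk; pose e := env_cons s (fun _ : 'I_1 => t).
have ek i : coherent_from k (sval (e i)).
  by rewrite /e /env_cons; case: unliftP.
have := lsat_chain_limit (LRel (set F) ord0 (lift ord0 ord0)) ek.
by rewrite /= /e env_cons0 env_consS.
Qed.

(** Stage [k.+1] is an ultrapower of stage [k], so it realizes [U]. The representative [t] is
    exposed because accessibility between classes is decided on coordinates. *)
Lemma chain_limit_realizes N (NF : same_ml_theory N)
    (U : ultrafilter_extension F) k (Q : set (chain N k)) :
  (forall A, sval U A -> exists2 x, Q x & mval A x) ->
  exists s : {s | @coherent N s},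
    [/\ coherent_from k.+1 (sval s),
        forall A, sval U A ->
          @mval _ (chain_limit N) A (upoint (chain N) nonprincipal s) &
        exists t : {t : seq (set F) -> chain N k | setT t},
          sval s k.+1 = upoint (fun=> chain N k) regular t /\
          forall l, Q (sval t l)].
Proof.
move=> UQ.
have [t [Qt tU]] := upower_realizes (same_ml_theory_chain k NF) UQ.
have [s sk st] := @coherent_through N k.+1 (upoint (fun=> chain N k) regular t).
exists (exist _ s (ex_intro _ k.+1 sk)); split=> // [A UA|]; last by exists t.
apply/(@mlsat_chain_limit N (Var A) (exist _ s (ex_intro _ k.+1 sk)) k.+1 sk).
by rewrite /= st; apply: tU.
Qed.

Lemma chain_limit_realizes_ultrafilter N (NF : same_ml_theory N)
    (U : ultrafilter_extension F) :
  exists c : chain_limit N, forall A, sval U A -> mval A c.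
Proof.
have [|s [_ sU _]] := @chain_limit_realizes N NF U 0 setT.
  (* [A] is nonempty, so [NVar A] is not globally true in [F], hence not in [N]. *)
  move=> A UA; apply: contrapT => nA.
  have [w Aw] := @filter_ex _ _ (@ultra_proper _ _ (svalP U)) A UA.
  suff H : forall w, mlsat id w (NVar A) by exact: H Aw.
  by apply: (NF (NVar A) Logic.I).1 => x Ax; apply: nA; exists x.
by exists (upoint (chain N) nonprincipal s).
Qed.

(** The point [c] already lives at some stage [k], where by elementarity it has a successor in each
    member of [U]; stage [k.+1] then contains a single successor realizing [U]. New points are
    served at later stages, hence the infinite chain. *)
Lemma chain_limit_modally_saturated N (NF : same_ml_theory N)
    (U : ultrafilter_extension F) (c : chain_limit N) :
  (forall A, sval U A -> exists2 d, acc c d & mval A d) ->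
  exists2 d, acc c d & forall A, sval U A -> mval A d.
Proof.
have [t ->] := upoint_surj c => cU; have [k tk] := svalP t.
have [|s [sk sU [r [sr rQ]]]] :=
  @chain_limit_realizes N NF U k (acc (sval t k)).
  move=> A /cU Ad.
  by move/(@mlsat_chain_limit N (Dia (Var A)) t k tk): Ad.
exists (upoint (chain N) nonprincipal s) => //.
have tk1 : coherent_from k.+1 (sval t) by move=> m /ltnW; apply: tk.
apply/(@acc_chain_limit _ t _ k.+1) => //=.
rewrite tk // sr; apply/(uacc regular_ultra (cst_seq_nonempty _)).
have UD := regular_ultra; by apply: filterS filterT => l _; apply: rQ.
Qed.

Lemma elementary_chain_limit (C : frame -> Prop) N :
  elementary C -> C N -> C (chain_limit N).
Proof.
move=> CE CN; apply: (elementary_uproduct nonprincipal_ultra) => //.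
  exact: coherent_witnessed.
elim=> [//|k Ck]; apply: (elementary_uproduct regular_ultra) => //.
exact: (witnessedT regular_ultra).
Qed.

(** * The bounded morphism onto the ultrafilter extension *)

Definition limit_map N (c : chain_limit N) : set_system F :=
  [set A | mval A c].

(** Each filter law, and the dichotomy between [A] and its complement, is an A-free formula globally
    true in [F] under [id], hence also in the limit. *)
Lemma limit_map_ultra N (NF : same_ml_theory N) (c : chain_limit N) :
  UltraFilter (limit_map c).
Proof.
have LF := same_ml_theory_chain_limit NF.
have cT : limit_map c setT by apply: (LF (Var setT) Logic.I).2.
have cS A B : A `<=` B -> limit_map c A -> limit_map c B.
  by move=> AB; apply: (mval_mono LF AB).
have cI A B : limit_map c A -> limit_map c B -> limit_map c (A `&` B).
  have : mlsat (@mval _ (chain_limit N)) c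
      (Or (NVar A) (Or (NVar B) (Var (A `&` B)))).
    apply: (LF _ _).2 => // w /=.
    by have [] := pselect (A w); have [] := pselect (B w); tauto.
  by move=> [|[|]].
have c0 : ~ limit_map c set0.
  exact: ((LF (NVar set0) Logic.I).2 (fun=> id) c).
have cF : ProperFilter (limit_map c) by split.
have cC A : limit_map c A \/ limit_map c (~` A).
  have /= := (LF (Or (Var A) (Var (~` A))) (conj Logic.I Logic.I)).2.
  by apply=> w; exact: EM.
split=> // G GF cG; apply/seteqP; split=> // A GA.
have [//|/cG GnA] := cC A.
by case: (@filter_not_empty _ G GF); rewrite -(setICr A); apply: filterI.
Qed.

Lemma limit_map_bounded_morphism N (NF : same_ml_theory N) :
  exists2 h : chain_limit N -> ultrafilter_extension F,
    bounded_morphism h & set_surj setT setT h.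
Proof.
have LF := same_ml_theory_chain_limit NF.
exists (fun c => exist _ (limit_map c) (limit_map_ultra NF c)).
  (* In [F] the variable naming the diamond of [A] agrees with [Dia (Var A)]; the two A-free
     implications transfer. They give the forth condition, and modal saturation gives the back
     condition. *)
  have dia A (c : chain_limit N) :
    @mval _ (chain_limit N) [set w | exists2 v, A v & acc w v] c <->
    exists2 d, acc c d & @mval _ (chain_limit N) A d.
    set dA := [set w | _].
    have d1 : mlsat (@mval _ (chain_limit N)) c (Or (NVar dA) (Dia (Var A))).
      apply: (LF _ _).2 => // w /=.
      have [[v Av wv]|] := pselect (dA w); last by left.
      by right; exists v.
    have d2 : mlsat (@mval _ (chain_limit N)) c (Or (Box (NVar A)) (Var dA)).
      apply: (LF _ _).2 => // w /=.
      have [|nA] := pselect (dA w); first by right.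
      by left=> v wv Av; apply: nA; exists v.
    split=> [cd|[v cv Av]]; first by case: d1.
    by case: d2 => // /(_ v cv).
  split=> [c d cd A /= Ad|c U /= cU].
    by apply/dia; exists d.
  have [A /cU/dia //|d cd dU] := @chain_limit_modally_saturated N NF U c.
  by exists d => //; apply: ue_point_eq.
move=> U _; have [c cU] := chain_limit_realizes_ultrafilter NF U.
by exists c => //; apply: ue_point_eq.
Qed.

End Saturation.

(** * Compactness *)

Fixpoint mlneg (Phi : Type) (f : mlform Phi) : mlform Phi :=
  match f with
  | Var p => NVar p
  | NVar p => Var p
  | And f g => Or (mlneg f) (mlneg g)
  | Or f g => And (mlneg f) (mlneg g)
  | Dia f => Box (mlneg f)
  | Box f => Dia (mlneg f)
  (* junk: the dual of [A] is not expressible *)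
  | Univ f => Univ f
  end.

Lemma univ_free_mlneg (Phi : Type) (f : mlform Phi) :
  univ_free f -> univ_free (mlneg f).
Proof. by elim: f => //= f IHf g IHg [/IHf ? /IHg]. Qed.

Lemma mlsat_mlneg (Phi : Type) (F : frame) (V : Phi -> set F) (f : mlform Phi)
    w : univ_free f -> mlsat V w (mlneg f) <-> ~ mlsat V w f.
Proof.
elim: f w => //= [p|f IHf g IHg|f IHf g IHg|f IHf|f IHf] w.
- by move=> _; split=> [? //|/contrapT].
- by move=> [/IHf -> /IHg ->]; rewrite not_andE.
- by move=> [/IHf -> /IHg ->]; rewrite not_orE.
- move=> fU; split=> [nf [v wv]|nf v wv]; first by apply/IHf/nf.
  by apply/IHf => // fv; apply: nf; exists v.
- move=> fU; split=> [[v wv /IHf nf] fA|]; first by apply: nf => //; apply: fA.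
  by move=> /existsNP[v /not_implyP[wv nf]]; exists v => //; apply/IHf.
Qed.

Lemma univ_free_iter_Box (Phi : Type) (f : mlform Phi) k :
  univ_free f -> univ_free (iter k (@Box Phi) f).
Proof. by elim: k. Qed.

Inductive reach (F : frame) (w : F) : F -> Prop :=
| reach_refl : reach w w
| reach_step u v : reach w u -> acc u v -> reach w v.

Lemma reach_iter_Box (F : frame) (w v : F) : reach w v ->
  exists k, forall (Phi : Type) (V : Phi -> set F) f,
    mlsat V w (iter k (@Box Phi) f) -> mlsat V v f.
Proof.
elim=> [|u {}v _ [k IHk] uv]; first by exists 0.
by exists k.+1 => Phi V f; rewrite iterSr => /IHk; apply.
Qed.

Lemma iter_Box_reach (Phi : Type) (F : frame) (V : Phi -> set F) f (w : F) k :
  (forall v, reach w v -> mlsat V v f) -> mlsat V w (iter k (@Box Phi) f).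
Proof.
move=> fR; suff H v : reach w v -> mlsat V v (iter k (@Box Phi) f).
  exact/H/reach_refl.
elim: k v => [|k IHk] v wv /=; first exact: fR.
by move=> u vu; apply: IHk; apply: reach_step vu.
Qed.

Section FiniteFalsification.
Variables (F : frame).
Implicit Types (M : model (set F)) (l : seq (mlform (set F))).

(** [g] is the disjunction of the negations of those A-free members of [l] that are true at [w],
    with a contradiction as empty disjunction. *)
Lemma point_refutation l (w : F) :
  exists2 g : mlform (set F), ~ mlsat id w g &
    forall M (v : M), ~ mlsat (@mval _ M) v g -> forall f, List.In f l ->
      univ_free f -> mlsat id w f -> mlsat (@mval _ M) v f.
Proof.
elim: l => [|f l [g nwg gP]].
  by exists (And (Var set0) (NVar set0)) => //= -[].
have [[fU wf]|nf] := pselect (univ_free f /\ mlsat id w f).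
  exists (Or (mlneg f) g) => [[/mlsat_mlneg|//]|M v /= /not_orP[nf ng]].
    exact.
  move=> f' [<- _ _|]; last exact: gP.
  by move: nf; rewrite mlsat_mlneg// => /contrapT.
exists g => // M v ng f' [<- fU wf|]; last exact: gP.
by case: nf.
Qed.

(* [A+] is what allows the refutations of finitely many independent points to be
   combined into a single formula. *)
Lemma points_refutation l (ws : seq F) :
  exists2 g : mlform (set F), forall w : F, ~ mlsat id w g &
    forall M (x : M), ~ mlsat (@mval _ M) x g -> forall w, List.In w ws ->
      exists v : M, forall f, List.In f l ->
        univ_free f -> mlsat id w f -> mlsat (@mval _ M) v f.
Proof.
elim: ws => [|w ws [g ng gP]].
  by exists (And (Var set0) (NVar set0)) => //= w -[].
have [h nh hP] := point_refutation l w.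
exists (Or (Univ h) g) => [x [/(_ w) //|]|]; first exact: ng.
move=> M x /= /not_orP[/existsNP[v nhv] ngx].
by move=> w' [<-|]; [exists v; apply: hP | apply: gP ngx _].
Qed.

End FiniteFalsification.

Section Compactness.
Variables (C : frame -> Prop) (F : frame) (ws : seq F).
Hypothesis C_elementary : elementary C.
Hypothesis C_generated : closed_generated_subframes C.
Hypothesis F_generated : forall v, exists2 w, List.In w ws & reach w v.
Hypothesis F_valid : forall f : mlform (set F),
  (forall G, C G -> forall (V : set F -> set G) x, mlsat V x f) ->
  forall w : F, mlsat id w f.

(** The refutation [g] fails in [F], so by [F_valid] it fails over a frame of [C], and that failure
    yields the points. *)
Lemma finite_approximation (l : seq (mlform (set F))) :
  exists M : model (set F), C M /\ exists v : F -> M,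
    forall w, List.In w ws -> forall f, List.In f l -> univ_free f ->
      mlsat id w f -> mlsat (@mval _ M) (v w) f.
Proof.
have [g ng gP] := points_refutation l ws.
have [w0] := world_inhabited F.
have : ~ forall G, C G -> forall (V : set F -> set G) x, mlsat V x g.
  by move=> /F_valid/(_ w0); apply: ng.
move=> /existsNP[G /not_implyP[CG /existsNP[V /existsNP[x nx]]]].
exists (Model V); split=> //.
have {}gP := gP (Model V) x nx.
suff /choice[v vP] : forall w, exists v : G, List.In w ws ->
    forall f, List.In f l -> univ_free f -> mlsat id w f -> mlsat V v f.
  by exists v.
move=> w; have [/gP[v vP]|] := pselect (List.In w ws); first by exists v.
by exists x.
Qed.

Lemma exists_same_ml_theory :
  exists2 N : model (set F), C N & same_ml_theory N.
Proof.
have [M MP] := choice finite_approximation.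
pose v l := sval (cid (proj2 (MP l))).
have vP l : forall w, List.In w ws -> forall f, List.In f l -> univ_free f ->
  mlsat id w f -> mlsat (@mval _ (M l)) (v l w) f := svalP (cid (proj2 (MP l))).
have [D [UD DP]] := regular_ultrafilter (mlform (set F)).
have [w0] := world_inhabited F.
have P0 : (setT : set (forall l, M l)) !=set0 by exists (fun l => v l w0).
pose K := uproduct M D P0; have MW := @witnessedT _ _ M D UD.
have CK : C K by apply: elementary_uproduct => // l; case: (MP l).
pose vK w : K := upoint M D (exist _ (fun l => v l w) Logic.I).
have vKP w f : List.In w ws -> univ_free f -> mlsat id w f ->
    mlsat (@mval _ K) (vK w) f.
  move=> ww fU wf; apply/(mlsat_uproduct UD P0 MW).
  by apply: filterS (DP f) => l lf; apply: vP.
pose X : set K := [set x | exists2 w, List.In w ws & reach (vK w) x].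
have gX : generated X.
  split=> [|x y [w ww wx] xy]; last by exists w => //; apply: reach_step xy.
  have [w ww _] := F_generated w0.
  by exists (vK w), w => //; apply: reach_refl.
pose N : model (set F) := @Model _ (subframe (proj1 gX))
  (fun A => [set x | mval A (sval x)]).
exists N; first exact: C_generated.
move=> f fU; split=> [fN w|fF [x [w ww wx]]].
  (* If [f] fails at [w], an iterated box of [f] fails at a generator [u], so its negation is true
     at [vK u]; yet [f] holds at every point reachable from [vK u]. *)
  apply: contrapT => nwf; have [u uw ruw] := F_generated w.
  have [k kP] := reach_iter_Box ruw.
  have kU := univ_free_iter_Box k fU.
  have := vKP u (mlneg (iter k (@Box _) f)) uw (univ_free_mlneg kU).
  rewrite mlsat_mlneg // mlsat_mlneg //; apply; first by move/kP.
  apply: iter_Box_reach => x ux; apply: contrapT => nxf.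
  have Xx : X x by exists u.
  have := @mlsat_restrict _ K X gX (@mval _ K) (mlneg f) (exist _ x Xx).
  rewrite !mlsat_mlneg //; apply => //; exact: (fN (exist _ x Xx)).
apply: (@mlsat_restrict _ K X gX (@mval _ K)) => /=.
(* [f] is true throughout [F], so its [k]-fold box is true at [w] and therefore at [vK w]. *)
have [k kP] := reach_iter_Box wx; apply: kP.
apply: vKP => //; first exact: univ_free_iter_Box.
by apply: iter_Box_reach.
Qed.

End Compactness.

(** * Change of the set of variables *)

Fixpoint mlrename (Psi Phi : Type) (r : Psi -> Phi) (f : mlform Psi) :
    mlform Phi :=
  match f with
  | Var p => Var (r p)
  | NVar p => NVar (r p)
  | And f g => And (mlrename r f) (mlrename r g)
  | Or f g => Or (mlrename r f) (mlrename r g)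
  | Dia f => Dia (mlrename r f)
  | Box f => Box (mlrename r f)
  | Univ f => Univ (mlrename r f)
  end.

Fixpoint mlvars (Psi : Type) (f : mlform Psi) : seq Psi :=
  match f with
  | Var p | NVar p => [:: p]
  | And f g | Or f g => mlvars f ++ mlvars g
  | Dia f | Box f | Univ f => mlvars f
  end.

Lemma mlsat_rename (Psi Phi : Type) (r : Psi -> Phi) (F : frame)
    (V : Phi -> set F) (V' : Psi -> set F) f w :
  (forall p, List.In p (mlvars f) -> V (r p) = V' p) ->
  mlsat V w (mlrename r f) <-> mlsat V' w f.
Proof.
elim: f w => //= [p|p|f IHf g IHg|f IHf g IHg|f IHf|f IHf|f IHf] w VV'.
- by rewrite VV' //; left.
- by rewrite VV' //; left.
- by rewrite IHf ?IHg // => p pf; apply: VV'; apply: List.in_or_app; auto.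
- by rewrite IHf ?IHg // => p pf; apply: VV'; apply: List.in_or_app; auto.
- by split=> -[v wv /(IHf _ VV')]; exists v.
- by split=> fA v wv; apply/(IHf _ VV'); apply: fA.
- by split=> fA v; apply/(IHf _ VV'); apply: fA.
Qed.

Lemma list_InP (T : eqType) (x : T) (s : seq T) : List.In x s <-> x \in s.
Proof.
elim: s => //= y s IHs; rewrite inE eq_sym; split.
  by case=> [->|/IHs ->]; rewrite ?eqxx ?orbT.
by case/predU1P => [|/IHs]; [left | right].
Qed.

Lemma infinite_injection (T : Type) :
  infinite_set [set: T] -> exists i : nat -> T, injective i.
Proof.
elim/Ppointed: T => T Tinf.
  by have [x _] := infinite_setN0 Tinf; case: (no x).
have /infiniteP/pcard_injP[i iI] := Tinf.
by exists i => x y; apply: iI; rewrite inE.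
Qed.

(** A variable is coded by its index in [l], embedded into [Phi] by [i]; [r'] decodes with [nth]. *)
Lemma infinite_retract (Psi Phi : Type) (Phi_infinite : infinite_set [set: Phi])
    (p0 : Psi) (l : seq Psi) :
  exists (r : Psi -> Phi) (r' : Phi -> Psi),
    forall p, List.In p l -> r' (r p) = p.
Proof.
have [i i_inj] := infinite_injection Phi_infinite.
have ch q : exists p : Psi, forall k, i k = q -> nth p0 l k = p.
  have [[k kq]|nq] := pselect (exists k, i k = q).
    by exists (nth p0 l k) => k'; rewrite -kq => /i_inj ->.
  by exists p0 => k kq; case: nq; exists k.
have [r' r'P] := choice ch.
exists (fun p => i (@index {classic Psi} p l)), r' => p.
rewrite (@list_InP {classic Psi}) -(r'P _ _ erefl).
exact: (@nth_index {classic Psi}).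
Qed.

(** The renamed formula is valid on [C], since valuations of [Phi] pull back along [r]; in [F],
    under [V] composed with [r'], it says what [f] says under [V]. *)
Lemma valid_rename (Phi Psi : Type) (Phi_infinite : infinite_set [set: Phi])
    (C : frame -> Prop) (F : frame) (f : mlform Psi) :
  mlvalid [set g : mlform Phi | forall G, C G -> mlvalid [set g] G] F ->
  (forall G, C G -> mlvalid [set f] G) -> mlvalid [set f] F.
Proof.
move=> FC fC V _ -> w.
(* Every formula contains a variable. *)
have p0 : Psi by elim: (f).
have [r [r' rK]] := infinite_retract Phi_infinite p0 (mlvars f).
rewrite -(@mlsat_rename _ _ r F (fun q => V (r' q)) V); last first.
  by move=> p /rK ->.
apply: FC => // G CG V' _ -> x.
rewrite (@mlsat_rename _ _ r _ V' (fun p => V' (r p))) //.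
by apply: fC CG _ _ _ _.
Qed.

(** * Finite generation *)

Lemma fg_reach (F : frame) (X : set F) (finX : finite_set X)
    (D := smallest (@generated F) X) : D !=set0 ->
  exists2 l : seq F, forall w, List.In w l -> D w &
    forall v, D v -> exists2 w, List.In w l & reach w v.
Proof.
move=> [w0 Dw0].
have [l lX] : exists l : seq F, forall x, List.In x l <-> X x.
  have [s sX] := (@finite_seqP {classic F} X).1 finX.
  by exists s => x; rewrite (@list_InP {classic F}) sX.
(* Adding [w0] keeps the set of reached points nonempty even when [X] is empty. *)
exists (w0 :: l) => [w [<- //|/lX Xw]|v]; first exact: sub_gen_smallest.
move/(_ [set v | exists2 w, List.In w (w0 :: l) & reach w v]); apply; split.
  split=> [|w {}v [u lu uw] wv]; last by exists u => //; apply: reach_step wv.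
  by exists w0, w0; [left | apply: reach_refl].
by move=> x /lX lx; exists x; [right | apply: reach_refl].
Qed.

Lemma reach_subframe (F : frame) (D : set F) (gD : generated D) (w v : F)
    (Dw : D w) : reach w v -> exists Dv : D v,
  @reach (subframe (proj1 gD)) (exist _ w Dw) (exist _ v Dv).
Proof.
elim=> [|u {}v _ [Du wu] uv]; first by exists Dw; apply: reach_refl.
by exists ((proj2 gD) _ _ Du uv); apply: reach_step wu _.
Qed.

Lemma lift_list (T : Type) (D : set T) (l : seq T) :
  (forall x, List.In x l -> D x) ->
  exists l' : seq {x | D x},
    forall x, List.In x l -> exists Dx : D x, List.In (exist _ x Dx) l'.
Proof.
elim: l => [|x l IHl] lD; first by exists [::].
have [l' l'P] : exists l' : seq {x | D x},
    forall x, List.In x l -> exists Dx : D x, List.In (exist _ x Dx) l'.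
  by apply: IHl => y yl; apply: lD; right.
have Dx : D x by apply: lD; left.
exists (exist _ x Dx :: l') => y [<-|/l'P[Dy ?]]; first by exists Dx; left.
by exists Dy; right.
Qed.

Lemma closure_definable (Phi : Type) (Phi_infinite : infinite_set [set: Phi])
    (C : frame -> Prop) (C_elementary : elementary C) :
  closed_generated_subframes C -> closed_bounded_morphic_images C ->
  reflects_ultrafilter_extensions C -> reflects_fg_subframes C ->
  mldefinable Phi C.
Proof.
move=> Cgen Cbm Cue Cfg.
(* The defining set is the full theory of [C]. *)
exists [set g : mlform Phi | forall G, C G -> mlvalid [set g] G] => F.
split=> [CF V f fC w|FC]; first exact: (fC F CF).
apply: Cfg => X finX D0; have gD := smallest_generated D0.
have -> : D0 = proj1 gD by apply: Prop_irrelevance.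
have {FC}GC := mlvalid_subframe (gD := gD) FC.
have [l lD lR] := fg_reach finX D0.
have [ws wsP] := lift_list lD.
set G := subframe (proj1 gD) in GC *.
have G_generated (v : G) : exists2 w : G, List.In w ws & reach w v.
  case: v => v Dv; have [w lw wv] := lR v Dv.
  have [Dw wws] := wsP w lw; exists (exist _ w Dw) => //.
  have [Dv' ] := reach_subframe gD Dw wv.
  by rewrite (Prop_irrelevance Dv' Dv).
have G_valid (f : mlform (set G)) :
    (forall H, C H -> forall (V : set G -> set H) x, mlsat V x f) ->
    forall w : G, mlsat id w f.
  move=> fC w; apply: (valid_rename Phi_infinite GC (f := f)) => //.
  by move=> H CH V _ -> x; apply: fC.
have [N CN NG] := exists_same_ml_theory C_elementary Cgen G_generated G_valid.
(* The limit over [N] is in [C], and [h] maps it onto the ultrafilter extension of [G]. *)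
apply: Cue; have [h hb hs] := limit_map_bounded_morphism NG.
by apply: Cbm hb hs _; apply: elementary_chain_limit.
Qed.

Theorem theorem3 (Phi : Type) (Phi_infinite : infinite_set [set: Phi])
    (C : frame -> Prop) (C_elementary : elementary C) :
  mldefinable Phi C <->
  [/\ closed_generated_subframes C,
      closed_bounded_morphic_images C,
      reflects_ultrafilter_extensions C &
      reflects_fg_subframes C].
Proof.
split=> [|[? ? ? ?]]; first exact: definable_closure.
exact: closure_definable.
Qed.
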